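(* Let $N$ be a positive integer, let $q=(q_0,\dots,q_N)$ be a relative equilibrium of the $(1+N)$-vortex problem, and let $(r,\theta)=(r_1,\dots,r_N,\theta_1,\dots,\theta_N)$ be the representation of $(q_1,\dots,q_N)$ in polar coordinates. Then $\theta$ is a critical point of the potential function $$V(\theta)=-\sum_{1\le i<j\le N}\left(\cos(\theta_i-\theta_j)+\frac12\log\bigl(2-2\cos(\theta_i-\theta_j)\bigr)\right).$$
   Context: For $(x,y)\in\mathbb{R}^2$ write $(x,y)^\perp=(-y,x)$. The $(N+1)$-vortex problem with circulations $\Gamma_0=1$, $\Gamma_1=\dots=\Gamma_N=\varepsilon$ (where $\varepsilon\in\mathbb{R}$ may have either sign) is the system for pairwise distinct $q_0,\dots,q_N\in\mathbb{R}^2$ $$\dot q_j=\sum_{i=0,\,i\ne j}^N \Gamma_i\frac{(q_j-q_i)^\perp}{|q_j-q_i|^2},\qquad j=0,\dots,N.$$ A relative equilibrium of it is a configuration that is a fixed point in the frame rotating rigidly about the origin at rate $\omega=1$, i.e. $q_j^\perp=\sum_{i\ne j}\Gamma_i\frac{(q_j-q_i)^\perp}{|q_j-q_i|^2}$ for all $j$; the center of vorticity is always taken at the origin: $q_0+\varepsilon(q_1+\dots+q_N)=0$. A relative equilibrium of the $(1+N)$-vortex problem is a configuration $(q_0,\dots,q_N)$ for which there are nonzero real numbers $\varepsilon_k\to0$ and, for each $k$, a relative equilibrium $(q_0^k,\dots,q_N^k)$ (as just described) of the $(N+1)$-vortex problem with $\varepsilon=\varepsilon_k$, such that $q_j^k\to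 q_j$ as $k\to\infty$ for $j=0,\dots,N$; moreover it is required that, for some $m,M>0$ independent of $k$, $|q_i^k-q_j^k|\ge m$ for $i\neq j$ and $|q_j^k|\le M$ for all $j$. The potential $V$ is defined on the set of $\theta\in\mathbb{R}^N$ with $\theta_i\not\equiv\theta_j \pmod{2\pi}$ for $i\ne j$. Polar coordinates are centered at the origin. *)

(* Defs.v *)
From HB Require Import structures.
From mathcomp Require Import all_boot all_order all_algebra.
From mathcomp Require Import all_classical all_reals all_analysis.

Set Implicit Arguments.
Unset Strict Implicit.
Unset Printing Implicit Defensive.

Import Order.TTheory GRing.Theory Num.Theory.
Import numFieldNormedType.Exports.

Local Open Scope classical_set_scope.
Local Open Scope ring_scope.

Section VortexProblem.
Context {R : realType}.

Definition perp (p : R * R) : R * R := (- p.2, p.1).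

(* The library norm on R * R is the maximum norm, which generates the same
   topology but is not the Euclidean length. *)
Definition enorm (p : R * R) : R := Num.sqrt (p.1 ^+ 2 + p.2 ^+ 2).

(* A configuration q : 'I_N.+1 -> R * R lists q_0, ..., q_N; the strong vortex
   is q ord0 and the i-th weak one is q (lift ord0 i), with i : 'I_N. *)

Definition circulation {N : nat} (eps : R) (j : 'I_N.+1) : R :=
  if j == ord0 then 1 else eps.

(* Right-hand side of the equation of motion of the j-th vortex. *)
Definition vortex_velocity {N : nat} (eps : R) (q : 'I_N.+1 -> R * R)
    (j : 'I_N.+1) : R * R :=
  \sum_(i < N.+1 | i != j)
    (circulation eps i / enorm (q j - q i) ^+ 2) *: perp (q j - q i).

(* Rotation about the origin at rate 1 has velocity field p |-> perp p. *)
Definition relative_equilibrium {N : nat} (eps : R)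
    (q : 'I_N.+1 -> R * R) : Prop :=
  [/\ injective q,
      q ord0 + eps *: \sum_(i < N) q (lift ord0 i) = 0 &
      forall j, perp (q j) = vortex_velocity eps q j].

(* Relative equilibria of the (1+N)-vortex problem. *)
Definition limit_relative_equilibrium {N : nat} (q : 'I_N.+1 -> R * R) : Prop :=
  exists (eps : nat -> R) (qs : nat -> 'I_N.+1 -> R * R),
    [/\ (forall k, eps k != 0) /\ (eps k @[k --> \oo] --> (0 : R)),
        forall k, relative_equilibrium (eps k) (qs k),
        forall j, qs k j @[k --> \oo] --> q j &
        exists m M : R,
          [/\ 0 < m, 0 < M,
              forall k i j, i != j -> m <= enorm (qs k i - qs k j) &
              forall k j, enorm (qs k j) <= M]].

Definition polar_representation {N : nat} (q : 'I_N.+1 -> R * R)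
    (r theta : 'rV[R]_N) : Prop :=
  forall i : 'I_N, 0 <= r ord0 i /\
    q (lift ord0 i) = (r ord0 i * cos (theta ord0 i),
                       r ord0 i * sin (theta ord0 i)).

(* The domain of V: angles pairwise distinct modulo 2 pi. *)
Definition V_domain {N : nat} : set 'rV[R]_N :=
  [set theta | forall i j : 'I_N, i != j ->
     forall k : int, theta ord0 i - theta ord0 j != k%:~R * (2 * pi)].

(* Outside V_domain this takes junk values, since ln 0 = 0. *)
Definition V {N : nat} (theta : 'rV[R]_N) : R :=
  - \sum_(i < N) \sum_(j < N | (i < j)%N)
      (cos (theta ord0 i - theta ord0 j)
       + 2^-1 * ln (2 - 2 * cos (theta ord0 i - theta ord0 j))).

(* Critical points of a function f with open domain D. *)
Definition critical_point {N : nat} (D : set 'rV[R]_N) (f : 'rV[R]_N -> R)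
    (x : 'rV[R]_N) : Prop :=
  [/\ D x, differentiable f x & 'd f x = (fun=> 0) :> ('rV[R]_N -> R)].

End VortexProblem.

(* Main.v *)
From HB Require Import structures.
Require Import Defs.
From mathcomp Require Import all_boot all_order all_algebra.
From mathcomp Require Import all_classical all_reals all_analysis.
From mathcomp Require Import ring lra.
Import Order.TTheory GRing.Theory Num.Theory.
Import numFieldNormedType.Exports.
Local Open Scope ring_scope.

(** Let the strong vortex be q_0 and the weak ones w_1, ..., w_N, at a genuine
    relative equilibrium with small circulation eps.  The equation for w_j is
    an equality of plane vectors, and it is read in the two directions attached
    to w_j.

    Radially, it says that |w_j|^2 equals w_j . (w_j - q_0) / |w_j - q_0|^2 plus
    eps times a sum that stays bounded since the vortices stay apart
    ([equilibrium_radial]).  The center of vorticity forces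
    q_0 = - eps (w_1 + ... + w_N), which tends to 0; hence in the limit the
    weak vortices lie on the unit circle ([limit_unit]).

    Tangentially, the left-hand side vanishes, and every remaining term
    carries a factor eps: the mutual interactions of weak vortices by their
    circulation, and the pull of the strong vortex because q_0 is itself eps
    times a combination of the w_i.  Dividing by eps before passing to the limit
    leaves a first-order condition ([equilibrium_tangential],
    [limit_balance]):
      sum over i <> j of (perp w_j . w_i) (1 - 1 / |w_j - w_i|^2) = 0.

    For points of the unit circle at angles theta_i, one has
    perp w_j . w_i = sin (theta_i - theta_j) and
    |w_j - w_i|^2 = 2 - 2 cos (theta_i - theta_j), so this sum is, up to
    sign, the partial derivative of V along theta_j ([is_diff_V],
    [sum_pairs_odd]). *)

(** * Euclidean products in the plane *)

(** [dot p p] is the square of [enorm p], and [dot (perp a) b] is the signed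
    area spanned by [a] and [b]: the two components of the equations of motion,
    radial and tangential, are both expressed with this one product. *)
Definition dot {R : realType} (a b : R * R) : R := a.1 * b.1 + a.2 * b.2.

Lemma enorm_sqr {R : realType} (p : R * R) : enorm p ^+ 2 = dot p p.
Proof. by rewrite sqr_sqrtr ?addr_ge0 ?sqr_ge0 // /dot -!expr2. Qed.

Lemma dotDr {R : realType} (p a b : R * R) : dot p (a + b) = dot p a + dot p b.
Proof. by rewrite /dot /=; ring. Qed.

Lemma dotZr {R : realType} (p : R * R) c (a : R * R) :
  dot p (c *: a) = c * dot p a.
Proof.
rewrite /dot -[(c *: a).1]/(c * a.1) -[(c *: a).2]/(c * a.2); ring.
Qed.

Lemma dot_sumr {R : realType} (I : finType) (P : pred I) (p : R * R)
    (F : I -> R * R) : dot p (\sum_(i | P i) F i) = \sum_(i | P i) dot p (F i).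
Proof.
apply: (big_morph (dot p)); first exact: dotDr.
by rewrite /dot /= !mulr0 addr0.
Qed.

Lemma dot_perp {R : realType} (a : R * R) : dot a (perp a) = 0.
Proof. by rewrite /dot /=; ring. Qed.

Lemma dot_perp_perp {R : realType} (a b : R * R) :
  dot (perp a) (perp b) = dot a b.
Proof. by rewrite /dot /=; ring. Qed.

(** Since [a] is orthogonal to its own rotation, only the position of [b]
    contributes to the torque of the velocity induced at [a] by [b]. *)
Lemma dot_perpB {R : realType} (a b : R * R) :
  dot a (perp (a - b)) = dot (perp a) b.
Proof. by rewrite /dot /=; ring. Qed.

(** * Relative equilibria with weak circulation eps *)

Lemma big_ord_lift_neq {R : realType} (N : nat) (j : 'I_N) (F : 'I_N.+1 -> R) :
  \sum_(i < N.+1 | i != lift ord0 j) F i =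
  F ord0 + \sum_(i < N | i != j) F (lift ord0 i).
Proof. by rewrite big_mkcond big_ord_recl /= [in RHS]big_mkcond. Qed.

(** Separates the strong vortex, of circulation 1, from the weak ones, whose
    common circulation factors out. *)
Lemma dot_velocity {R : realType} (N : nat) (eps : R) (q : 'I_N.+1 -> R * R)
    (p : R * R) (j : 'I_N) :
  dot p (vortex_velocity eps q (lift ord0 j)) =
  dot p (perp (q (lift ord0 j) - q ord0))
    / dot (q (lift ord0 j) - q ord0) (q (lift ord0 j) - q ord0)
  + eps * \sum_(i < N | i != j)
      dot p (perp (q (lift ord0 j) - q (lift ord0 i)))
      / dot (q (lift ord0 j) - q (lift ord0 i))
            (q (lift ord0 j) - q (lift ord0 i)).
Proof.
rewrite /vortex_velocity dot_sumr big_ord_lift_neq mulr_sumr; congr (_ + _).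
  by rewrite dotZr enorm_sqr /circulation eqxx div1r mulrC.
apply: eq_bigr => i _.
by rewrite dotZr enorm_sqr /circulation /= mulrAC mulrA.
Qed.

Section Equilibrium.
Context {R : realType} {N : nat} {eps : R} {q : 'I_N.+1 -> R * R}.
Context (eq_q : relative_equilibrium eps q).
Local Notation w i := (q (lift ord0 i)).

(** The equation of the weak vortex [j] tested against [perp (w j)]; rotating
    both arguments turns this into a product with [w j]. *)
Lemma equilibrium_radial (j : 'I_N) :
  dot (w j) (w j) = dot (w j) (w j - q ord0)
      / dot (w j - q ord0) (w j - q ord0)
    + eps * \sum_(i < N | i != j)
        dot (w j) (w j - w i) / dot (w j - w i) (w j - w i).
Proof.
have [_ _ /(_ (lift ord0 j)) eqj] := eq_q.
rewrite -{1}dot_perp_perp {2}eqj dot_velocity dot_perp_perp.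
by under eq_bigr do rewrite dot_perp_perp.
Qed.

(** The equation of the weak vortex [j] tested against [w j], divided by [eps].
    Replacing [q ord0] by [- eps] times the sum of the weak vortices puts the
    factor [eps] into the contribution of the strong one as well; in that sum
    the term of index [j] drops out. *)
Lemma equilibrium_tangential (j : 'I_N) : eps != 0 ->
  \sum_(i < N | i != j) dot (perp (w j)) (w i)
     * ((dot (w j - q ord0) (w j - q ord0))^-1
        - (dot (w j - w i) (w j - w i))^-1) = 0.
Proof.
move=> eps0; have [_ q0 /(_ (lift ord0 j)) eqj] := eq_q.
have := dot_velocity N eps q (w j) j.
rewrite -eqj dot_perp dot_perpB.
set d0 := dot (w j - q ord0) (w j - q ord0).
have -> : q ord0 = - eps *: \sum_(i < N) w i.
  by rewrite scaleNr; apply/eqP; rewrite -addr_eq0 q0.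
rewrite dotZr dot_sumr (bigD1 j) //=.
have -> : dot (perp (w j)) (w j) = 0 by rewrite /dot /=; ring.
rewrite add0r; under [X in eps * X]eq_bigr do rewrite dot_perpB.
under [in X in _ -> X]eq_bigr do rewrite mulrBr.
rewrite sumrB -mulr_suml => E; apply: (mulfI eps0).
by apply: oppr_inj; rewrite mulr0 oppr0 [RHS]E; ring.
Qed.

End Equilibrium.

(** * Passing to the limit *)

Section Limit.
Local Open Scope classical_set_scope.

Lemma cvg_proj1 {R : realType} (T : Type) (F : set_system T) (FF : Filter F)
    (f : T -> R * R) (a : R * R) : f @ F --> a -> (f x).1 @[x --> F] --> a.1.
Proof. by case: a => a1 a2 fa; exact: (cvg_comp _ _ fa cvg_fst). Qed.

Lemma cvg_proj2 {R : realType} (T : Type) (F : set_system T) (FF : Filter F)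
    (f : T -> R * R) (a : R * R) : f @ F --> a -> (f x).2 @[x --> F] --> a.2.
Proof. by case: a => a1 a2 fa; exact: (cvg_comp _ _ fa cvg_snd). Qed.

Lemma cvg_dot {R : realType} (T : Type) (F : set_system T) (FF : Filter F)
    (f g : T -> R * R) (a b : R * R) :
  f @ F --> a -> g @ F --> b -> dot (f x) (g x) @[x --> F] --> dot a b.
Proof.
by move=> fa gb; apply: cvgD; apply: cvgM;
  [exact: cvg_proj1|exact: cvg_proj1|exact: cvg_proj2|exact: cvg_proj2].
Qed.

Lemma cvg_dot_perp {R : realType} (T : Type) (F : set_system T)
    (FF : Filter F) (f g : T -> R * R) (a b : R * R) :
  f @ F --> a -> g @ F --> b ->
  dot (perp (f x)) (g x) @[x --> F] --> dot (perp a) b.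
Proof.
move=> fa gb; apply: cvgD; apply: cvgM; [apply: cvgN| | |];
  by [exact: cvg_proj1|exact: cvg_proj2].
Qed.

Lemma cvg_sumr {R : realType} (T : Type) (F : set_system T) (FF : Filter F)
    (I : finType) (P : pred I) (f : I -> T -> R) (a : I -> R) :
  (forall i, P i -> f i x @[x --> F] --> a i) ->
  \sum_(i | P i) f i x @[x --> F] --> \sum_(i | P i) a i.
Proof. by move=> fa; apply: cvg_big => //; exact: add_continuous. Qed.

Context {R : realType} {N : nat} {q : 'I_N.+1 -> R * R}.
Context (lim_q : limit_relative_equilibrium q).
Local Notation w i := (q (lift ord0 i)).

(** The lower bound on the distances is uniform along the sequence, so it
    survives in the limit; this is what makes inverse squared distances
    converge. *)
Lemma limit_separated (i j : 'I_N.+1) : i != j ->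
  0 < dot (q i - q j) (q i - q j).
Proof.
move=> ij; have [eps [qs [_ _ qsq [m [_ [m0 _ sep _]]]]]] := lim_q.
have cv : dot (qs k i - qs k j) (qs k i - qs k j) @[k --> \oo]
    --> dot (q i - q j) (q i - q j).
  by apply: cvg_dot; apply: cvgB; exact: qsq.
apply: (@lt_le_trans _ _ (m ^+ 2)); first by rewrite exprn_gt0.
rewrite -(cvg_lim _ cv)//; apply: limr_ge.
  by apply/cvg_ex; eexists; exact: cv.
near=> k; rewrite -enorm_sqr lerXn2r ?nnegrE ?sqrtr_ge0 ?(ltW m0) //.
exact: sep.
Unshelve. all: end_near. Qed.

Lemma limit_strong : q ord0 = 0.
Proof.
have [eps [qs [[_ eps_cvg] eqq qsq _]]] := lim_q.
have q0E k : qs k ord0 = - eps k *: \sum_(i < N) qs k (lift ord0 i).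
  have [_ q0 _] := eqq k.
  by rewrite scaleNr; apply/eqP; rewrite -addr_eq0 q0.
have cv : qs k ord0 @[k --> \oo] --> - 0 *: \sum_(i < N) q (lift ord0 i).
  under eq_fun do rewrite q0E.
  apply: cvgZ; first exact: cvgN.
  by apply: cvg_big => [|i _]; [exact: add_continuous|exact: qsq].
rewrite oppr0 scale0r in cv.
by apply: (cvg_unique _ (qsq ord0) cv); exact: norm_hausdorff.
Qed.

Lemma cvg_inv_dist (qs : nat -> 'I_N.+1 -> R * R) (i j : 'I_N.+1) :
  (forall l, qs k l @[k --> \oo] --> q l) -> i != j ->
  (dot (qs k i - qs k j) (qs k i - qs k j))^-1 @[k --> \oo]
    --> (dot (q i - q j) (q i - q j))^-1.
Proof.
move=> qsq ij; apply: cvgV; first by rewrite gt_eqF// limit_separated.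
by apply: cvg_dot; apply: cvgB; exact: qsq.
Qed.

(** The radial equation in the limit reads |w_j|^2 = |w_j|^2 / |w_j|^2, and
    the separation from the strong vortex, which sits at 0, makes the right-hand
    side equal to 1. *)
Lemma limit_unit (j : 'I_N) : dot (w j) (w j) = 1.
Proof.
have [eps [qs [[_ eps_cvg] eqq qsq _]]] := lim_q.
have cvl : dot (qs k (lift ord0 j)) (qs k (lift ord0 j)) @[k --> \oo]
  --> dot (w j) (w j) by apply: cvg_dot; exact: qsq.
have cvr : dot (qs k (lift ord0 j)) (qs k (lift ord0 j)) @[k --> \oo]
  --> dot (w j) (w j - q ord0) / dot (w j - q ord0) (w j - q ord0)
    + 0 * \sum_(i < N | i != j)
        dot (w j) (w j - w i) / dot (w j - w i) (w j - w i).
  under eq_fun => k do rewrite (equilibrium_radial (eqq k)).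
  apply: cvgD; last apply: cvgM => //.
    apply: cvgM; last by apply: cvg_inv_dist; rewrite // eq_sym.
    by apply: cvg_dot; [exact: qsq|apply: cvgB; exact: qsq].
  apply: cvg_sumr => i ij; apply: cvgM.
    by apply: cvg_dot; [exact: qsq|apply: cvgB; exact: qsq].
  by apply: cvg_inv_dist; rewrite // eq_sym.
have -> := cvg_unique _ cvl cvr; last exact: norm_hausdorff.
have := limit_separated (lift ord0 j) ord0 isT.
rewrite limit_strong subr0 mul0r addr0 => w0.
by rewrite divff// gt_eqF.
Qed.

(** The first-order balance that survives division by eps: a condition on the
    limit configuration alone, since each |w_j - q_0| tends to 1. *)
Lemma limit_balance (j : 'I_N) :
  \sum_(i < N | i != j)
    dot (perp (w j)) (w i) * (1 - (dot (w j - w i) (w j - w i))^-1) = 0.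
Proof.
have [eps [qs [[eps0 eps_cvg] eqq qsq _]]] := lim_q.
(* The constant 0 is written as the tangential sum of the k-th configuration, so
   its limit can be computed term by term. *)
have cv : (0 : R) @[k --> \oo] --> \sum_(i < N | i != j)
    dot (perp (w j)) (w i) * ((dot (w j - q ord0) (w j - q ord0))^-1
       - (dot (w j - w i) (w j - w i))^-1).
  under eq_fun => k do
    rewrite -(equilibrium_tangential (eqq k) j (eps0 k)).
  apply: cvg_sumr => i ij; apply: cvgM.
    by apply: cvg_dot_perp; exact: qsq.
  by apply: cvgB; apply: cvg_inv_dist; rewrite // eq_sym.
rewrite [RHS](cvg_unique _ (cvg_cst 0) cv); last exact: norm_hausdorff.
by apply: eq_bigr => i _; rewrite limit_strong subr0 limit_unit invr1.
Qed.

End Limit.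

(** * The potential *)

Section Potential.
Context {R : realType}.
Implicit Type x : R.

Definition pair_potential x : R := cos x + 2^-1 * ln (2 - 2 * cos x).

Definition pair_force x : R := sin x * ((2 - 2 * cos x)^-1 - 1).

Lemma pair_force_odd x : pair_force (- x) = - pair_force x.
Proof. by rewrite /pair_force cosN sinN mulNr. Qed.

Lemma is_derive_pair_potential x : cos x != 1 ->
  is_derive x 1 pair_potential (pair_force x).
Proof.
move=> cx1; have gap_gt0 : 0 < 2 - 2 * cos x.
  by have := cos_le1 x; rewrite le_eqVlt (negbTE cx1) /=; lra.
have dgap : is_derive x 1 (fun y : R => 2 - 2 * cos y) (2 * sin x).
  apply: is_derive_eq; rewrite /GRing.scale /=; ring.
have dln := is_derive1_ln gap_gt0.
have dcomp := @is_derive1_comp _ _ (fun y => 2 - 2 * cos y) _ _ _ dln dgap.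
have dpp := is_deriveD (is_derive_cos x) (is_deriveZ 2^-1 dcomp).
apply: (is_derive_eq dpp).
rewrite /pair_force /GRing.scale /=; field.
by rewrite gt_eqF.
Qed.

(** The derivative in one variable, repackaged so that it composes with the
    multivariate differentials of the coordinates. *)
Lemma is_derive1_diff (f : R -> R) x df :
  is_derive x 1 f df -> is_diff x f (fun h => h * df).
Proof.
move=> [dfx dfE]; apply: DiffDef; first exact/derivable1_diffP.
by rewrite deriv1E// derive1E dfE.
Qed.

Lemma is_diff_sum (U W : normedModType R) (I : finType) (P : pred I)
    (f df : I -> U -> W) (u : U) :
  (forall i, P i -> is_diff u (f i) (df i)) ->
  is_diff u (fun v => \sum_(i | P i) f i v) (fun h => \sum_(i | P i) df i h).
Proof.
move=> fdf.
have -> : (fun v => \sum_(i | P i) f i v) = \sum_(i | P i) f i.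
  by apply/funext => v; rewrite fct_sumE.
have -> : (fun v => \sum_(i | P i) df i v) = \sum_(i | P i) df i.
  by apply/funext => v; rewrite fct_sumE.
elim/big_ind2: _ => [|f1 df1 f2 df2 d1 d2|i Pi].
- exact: is_diff_cst.
- exact: is_diffD.
- exact: fdf.
Qed.

Lemma is_diff_coord (n : nat) (u : 'rV[R]_n) (i : 'I_n) :
  is_diff u (fun v : 'rV[R]_n => v ord0 i) (fun h => h ord0 i).
Proof.
apply: DiffDef; first exact: differentiable_coord.
have lin : linear (fun v : 'rV[R]_n => v ord0 i).
  by move=> a v1 v2; rewrite !mxE.
pose L : {linear 'rV[R]_n -> R} :=
  HB.pack (fun v : 'rV[R]_n => v ord0 i) (GRing.isLinear.Build _ _ _ _ _ lin).
rewrite -[fun v : 'rV[R]_n => v ord0 i]/(L : _ -> _); apply: diff_lin.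
exact: coord_continuous.
Qed.

(** The cosine condition keeps every logarithm in V away from its singularity
    at coinciding angles. *)
Lemma is_diff_V (N : nat) (theta : 'rV[R]_N) :
  (forall i j : 'I_N, i != j -> cos (theta ord0 i - theta ord0 j) != 1) ->
  is_diff theta V (fun h => - \sum_(i < N) \sum_(j < N | (i < j)%N)
    (h ord0 i - h ord0 j) * pair_force (theta ord0 i - theta ord0 j)).
Proof.
move=> neq1; apply: is_diffN; apply: is_diff_sum => i _.
apply: is_diff_sum => j ij.
have neq : i != j by rewrite neq_ltn ij.
have dpp := is_derive1_diff _ _ _ (is_derive_pair_potential _ (neq1 i j neq)).
have dij := is_diffB (is_diff_coord _ theta i) (is_diff_coord _ theta j).
exact: (@is_diff_comp _ _ _ _ _ _ _ _ _ dij dpp).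
Qed.

(** Each unordered pair acts on its two members by opposite forces, so that a
    sum over pairs regroups into the total force on each member. *)
Lemma sum_pairs_odd (N : nat) (f : 'I_N -> 'I_N -> R) (h : 'I_N -> R) :
  (forall i j, f j i = - f i j) ->
  \sum_(i < N) \sum_(j < N | (i < j)%N) (h i - h j) * f i j =
  \sum_(i < N) h i * \sum_(j < N | j != i) f i j.
Proof.
move=> fodd.
have E : \sum_(i < N) \sum_(j < N | (i < j)%N) (h i - h j) * f i j =
  \sum_(i < N) \sum_(j < N | (i < j)%N) h i * f i j +
  \sum_(i < N) \sum_(j < N | (j < i)%N) h i * f i j.
  rewrite [X in _ = _ + X](exchange_big_dep predT)//= -big_split/=.
  apply: eq_bigr => i _; rewrite -big_split/=; apply: eq_bigr => j _.
  by rewrite (fodd i j); ring.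
rewrite E -big_split/=; apply: eq_bigr => i _.
rewrite mulr_sumr [RHS](bigID (fun j : 'I_N => (i < j)%N))/=.
congr (_ + _); apply: eq_bigl => j; rewrite -val_eqE /=;
  by case: (ltngtP i j).
Qed.

End Potential.

(** * Critical points *)

Lemma cos_intmul2pi {R : realType} (k : int) : cos (k%:~R * (2 * pi)) = 1 :> R.
Proof.
have cos_nat (n : nat) : cos (n%:R * (2 * pi)) = 1 :> R.
  have -> : n%:R * (2 * pi) = 0 + (pi *+ 2) *+ n :> R.
    by rewrite add0r -[RHS]mulr_natl -(mulr_natl pi).
  by rewrite (periodicn (@cosD2pi R)) cos0.
case: k => n; first exact: cos_nat.
by rewrite NegzE mulrNz mulNr cosN; exact: cos_nat.
Qed.

Lemma polar_unit {R : realType} (a c s : R) : 0 <= a -> c ^+ 2 + s ^+ 2 = 1 ->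
  dot (a * c, a * s) (a * c, a * s) = 1 -> a = 1.
Proof.
move=> a0 cs; rewrite /dot /= => E.
have : a ^+ 2 = 1.
  by rewrite -E -[LHS]mulr1 -cs; ring.
by move=> /eqP; rewrite sqrp_eq1// => /eqP.
Qed.

Theorem lemma2 (R : realType) (N : nat) (hN : (0 < N)%N)
    (q : 'I_N.+1 -> R * R) (hq : limit_relative_equilibrium q)
    (r theta : 'rV[R]_N) (hpolar : polar_representation q r theta) :
  critical_point V_domain V theta.
Proof.
have qE i : q (lift ord0 i) = (cos (theta ord0 i), sin (theta ord0 i)).
  have [r0 qi] := hpolar i; have := limit_unit hq i.
  rewrite qi => /(polar_unit _ _ _ r0 (cos2Dsin2 _)) ->.
  by rewrite !mul1r.
have gapE i j : dot (q (lift ord0 i) - q (lift ord0 j))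
    (q (lift ord0 i) - q (lift ord0 j))
    = 2 - 2 * cos (theta ord0 i - theta ord0 j).
  have := cos2Dsin2 (theta ord0 i); have := cos2Dsin2 (theta ord0 j).
  by rewrite cosB !qE /dot /=; nra.
have neq1 i j : i != j -> cos (theta ord0 i - theta ord0 j) != 1.
  move=> ij; have : lift ord0 i != lift ord0 j by rewrite (inj_eq lift_inj).
  move=> /(limit_separated hq); rewrite gapE.
  by apply: contraTneq => ->; rewrite mulr1 subrr ltxx.
have dV := is_diff_V _ _ neq1.
split.
- move=> i j ij k; apply: contraNneq (neq1 i j ij) => ->.
  by rewrite cos_intmul2pi.
- exact: ex_diff.
- rewrite diff_val; apply/funext => h.
  rewrite (sum_pairs_odd _
    (fun i j => pair_force (theta ord0 i - theta ord0 j))); last first.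
    by move=> i j; rewrite -pair_force_odd opprB.
  rewrite big1 ?oppr0// => j _; apply/eqP; rewrite mulf_eq0; apply/orP; right.
  apply/eqP.
  rewrite -[RHS](limit_balance hq j); apply: eq_bigr => i ij.
  rewrite gapE /pair_force sinB !qE /dot /=; ring.
Qed.
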